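(* Let $k \ge 1$, let $X, Y, U_i, V_i$ ($i=1,2,\ldots,k$) be finite-dimensional normed spaces, let $F : X \rightrightarrows Y$ be a closed sublinear surjective set-valued mapping, and let $P_i : V_i \to Y$ and $Q_i : X \to U_i$ ($i=1,2,\ldots,k$) be linear mappings. Then the following four quantities are equal: $$\inf_{T_i \in L(U_i,V_i)} \Big\{ \max_i \|T_i\| : F + \sum_i P_i T_i Q_i \text{ is nonsurjective} \Big\};$$ $$\inf_{\text{rank-one } T_i \in L(U_i,V_i)} \Big\{ \max_i \|T_i\| : F + \sum_i P_i T_i Q_i \text{ is nonsurjective} \Big\};$$ $$\inf_{u_i^* \in B_{U_i^*},\; z_i \ge 0,\; 0 \ne y^* \in Y^*} \Big\{ \max_i \frac{z_i}{\|P_i^* y^*\|} : \sum_i z_i Q_i^* u_i^* \in F^*(y^* ) \Big\};$$ $$\inf_{v_i \in B_{V_i}} \; \sup_{x \in X,\; w_i > 0} \Big\{ \min_i \frac{w_i}{\|Q_i x\|} : \sum_i w_i P_i v_i \in F(x) \Big\}.$$ Furthermore, if these quantities are finite, each infimum above is attained (in the fourth expression this refers to the outer infimum over $(v_1,\ldots,v_k) \in B_{V_1} \times \cdots \times B_{V_k}$).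
   Context: All normed spaces are real, with arbitrary norms. $L(U,V)$ is the space of linear mappings from $U$ to $V$ with the operator norm. A mapping in $L(U,V)$ is called rank-one if it has the form $u \mapsto \langle u^*, u\rangle v$ for some $u^* \in U^*$ and $v \in V$ (so the zero mapping is included). $B_X$ is the closed unit ball of $X$, and $X^*$ is the dual space with the dual norm; $P^*$, $Q^*$ denote the usual adjoints of linear mappings. For a set-valued mapping $F : X \rightrightarrows Y$, the graph is $\{(x,y) \in X \times Y : y \in F(x)\}$. $F$ is closed if its graph is closed. $F$ is sublinear if its graph is a convex cone, where a cone is a nonempty set closed under nonnegative scalar multiplication. $F$ is surjective if $F(X) := \bigcup_{x \in X} F(x) = Y$. For a linear $G : X \to Y$, $(F+G)(x) = F(x) + Gx$. The adjoint $F^* : Y^* \rightrightarrows X^*$ is the set-valued mapping defined by: $x^* \in F^*(y^* )$ if and only if $\langle y^*, y\rangle \ge \langle x^*, x\rangle$ whenever $y \in F(x)$. Conventions: for real $z \ge 0$, $z/0 = +\infty$ if $z > 0$ and $z/0 = 0$ if $z = 0$. Infima and suprema are taken in $[0,+\infty]$, with the infimum of the empty set equal to $+\infty$. *)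

(* Defs.v *)
From HB Require Import structures.
From mathcomp Require Import all_boot all_order all_algebra.
From mathcomp Require Import all_classical all_reals all_analysis.

Set Implicit Arguments.
Unset Strict Implicit.
Unset Printing Implicit Defensive.

Import Order.TTheory GRing.Theory Num.Theory.
Import numFieldNormedType.Exports.

Local Open Scope classical_set_scope.
Local Open Scope ring_scope.

(* Finite-dimensional real normed spaces: [Vector] supplies the finite
   dimension, while the norm is arbitrary and induces the topology. *)
#[short(type="finNormedModType")]
HB.structure Definition FinNormedModule (R : realType) :=
  {V of NormedModule R V & Vector R V}.

HB.instance Definition _ (R : realType) := Vector.on R^o.

Section Linear.
Context {R : realType}.
Implicit Types U V X : finNormedModType R.

(* The set is nonempty and, since U is finite-dimensional, bounded, so this
   real supremum is never a default value. With V := R^o it is the dual norm. *)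
Definition opnorm {U V} (T : 'Hom(U, V)) : R :=
  sup [set `|T u| | u in [set u : U | `|u| <= 1]].

Definition rank_one {U V} (T : 'Hom(U, V)) : Prop :=
  exists (u' : 'Hom(U, R^o)) (v : V), forall u, T u = (u' u : R) *: v.

Definition lin_adjoint {U V} (T : 'Hom(U, V)) (v' : 'Hom(V, R^o)) :
  'Hom(U, R^o) := (v' \o T)%VF.

End Linear.

Section SetValued.
Context {R : realType} {X Y : finNormedModType R}.
Implicit Types F : X -> set Y.

Definition sv_graph F : set (X * Y) := [set p | F p.1 p.2].

Definition sv_closed F : Prop := closed (sv_graph F).

Definition cone {E : lmodType R} (C : set E) : Prop :=
  C !=set0 /\ forall (a : R) (x : E), 0 <= a -> C x -> C (a *: x).

Definition sublinear F : Prop := cone (sv_graph F) /\ convex_set (sv_graph F).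

Definition sv_surjective F : Prop := \bigcup_(x in setT) F x = setT.

Definition sv_add F (G : 'Hom(X, Y)) : X -> set Y :=
  fun x => [set y + G x | y in F x].

Definition sv_adjoint F (y' : 'Hom(Y, R^o)) : set 'Hom(X, R^o) :=
  [set x' | forall x y, F x y -> (y' y : R) >= (x' x : R)].

End SetValued.

Section Quantities.
Context {R : realType}.

(* z / n for z, n >= 0, with z / 0 = +oo if z > 0 and 0 / 0 = 0. *)
Definition ratio (z n : R) : \bar R :=
  if n == 0 then (if z == 0 then 0%E else +oo%E) else (z / n)%:E.

(* Supremum in [0, +oo]: the supremum of the empty set is 0. *)
Definition nnsup (A : set (\bar R)) : \bar R := ereal_sup (0%E |` A).

Context {k : nat} {X Y : finNormedModType R}.
Context {U V : 'I_k -> finNormedModType R}.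
Variables (F : X -> set Y).
Variables (P : forall i, 'Hom(V i, Y)) (Q : forall i, 'Hom(X, U i)).

Definition perturbed (T : forall i, 'Hom(U i, V i)) : X -> set Y :=
  sv_add F (\sum_(i < k) (P i \o T i \o Q i)%VF).

(* The sets whose infima are the four quantities. They consist of nonnegative
   extended reals, so that [ereal_inf] is the infimum in [0, +oo]. *)

Definition linear_values : set (\bar R) :=
  [set t | exists T : forall i, 'Hom(U i, V i),
    ~ sv_surjective (perturbed T) /\
    t = (\big[Num.max/0]_(i < k) opnorm (T i))%:E].

Definition rank_one_values : set (\bar R) :=
  [set t | exists T : forall i, 'Hom(U i, V i),
    [/\ forall i, rank_one (T i),
        ~ sv_surjective (perturbed T) &
        t = (\big[Num.max/0]_(i < k) opnorm (T i))%:E]].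

Definition dual_values : set (\bar R) :=
  [set t | exists (u' : forall i, 'Hom(U i, R^o)) (z : 'I_k -> R)
                  (y' : 'Hom(Y, R^o)),
    [/\ forall i, opnorm (u' i) <= 1,
        forall i, 0 <= z i,
        y' <> 0,
        sv_adjoint F y' (\sum_(i < k) z i *: lin_adjoint (Q i) (u' i)) &
        t = \big[maxe/0%E]_(i < k)
              ratio (z i) (opnorm (lin_adjoint (P i) y'))]].

Definition primal_values : set (\bar R) :=
  [set t | exists v : forall i, V i,
    (forall i, `|v i| <= 1) /\
    t = nnsup [set s | exists (x : X) (w : 'I_k -> R),
          [/\ forall i, 0 < w i,
              F x (\sum_(i < k) w i *: P i (v i)) &
              s = \big[mine/+oo%E]_(i < k) ratio (w i) `|Q i x|]]].

End Quantities.

(* Main.v *)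
From HB Require Import structures.
Require Import Defs.
From mathcomp Require Import all_boot all_order all_algebra.
From mathcomp Require Import all_classical all_reals all_analysis.
From mathcomp Require Import lra.

Set Implicit Arguments.
Unset Strict Implicit.
Unset Printing Implicit Defensive.

Import Order.TTheory GRing.Theory Num.Theory.
Import numFieldNormedType.Exports.
Import VectorInternalTheory.

Local Open Scope classical_set_scope.
Local Open Scope ring_scope.

(* Call a radius r >= 0 feasible when some y' <> 0 and functionals m_i satisfy
   |m_i| <= r |P_i^* y'| and sum_i Q_i^* m_i \in F^*(y').  Each of the four
   quantities is the infimum of the feasible radii, because each of its finite
   values is feasible and conversely every feasible r bounds one of its values:
   - F + G is nonsurjective iff a nonzero y' is nonnegative on its range, so a
     perturbation T yields m_i = - T_i^* P_i^* y', while v_i in the unit ball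
     with <P_i^* y', v_i> = |P_i^* y'| turns m_i back into the rank-one map
     u |-> - m_i(u) v_i / |P_i^* y'|;
   - the vectors - v_i make every competitor of the inner supremum of the fourth
     quantity at most r, by surjectivity of F; conversely, if that supremum is at
     most s, then 0 is not in the convex cone of the points
     (y - sum_i w_i P_i v_i, (Q_i x + p_i)_i) with y in F x and w_i > s |p_i|, and
     a separating functional is exactly a feasible pair (y', (- m_i)_i).
   Normalising y' makes the feasible radii a projection of a closed, locally
   bounded set, so the least one exists, and it attains all four infima. *)

(** * Separation of convex cones *)

Section Separation.
Context {R : realType}.

(** Induction on the dimension. If the first coordinate [a] keeps one sign on [C], it or its
    opposite is the functional. Otherwise the slice [a = 0] inherits the hypotheses, induction
    supplies a functional [f] on it, and only the coefficient of [a] remains to be chosen. *)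
Lemma cone_separation (n : nat) (C : set 'rV[R]_n) :
  C !=set0 -> (forall x y, C x -> C y -> C (x + y)) ->
  (forall t x, 0 < t -> C x -> C (t *: x)) -> ~ C 0 ->
  exists2 a : 'cV[R]_n, a != 0 & forall x, C x -> 0 <= (x *m a) 0 0.
Proof.
elim: n C => [|n IH]; last rewrite -[n.+1]/(1 + n)%N; move=> C C0 CD CZ nC0.
  by case: C0 => x Cx; case: nC0; rewrite (_ : 0 = x)//; apply/matrixP => i [].
pose a (x : 'rV[R]_(1 + n)) := lsubmx x 0 0.
have rowE (x : 'rV[R]_(1 + n)) : x = row_mx (a x)%:M (rsubmx x).
  by rewrite /a -mx11_scalar hsubmxK.
have scaleE s (x : 'rV[R]_(1 + n)) :
    s *: x = row_mx (s * a x)%:M (s *: rsubmx x).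
  by rewrite {1}(rowE x) scale_row_mx scale_scalar_mx.
pose e0 (s : R) : 'cV[R]_(1 + n) := col_mx s%:M 0.
have sgn_nz (s : R) : s != 0 -> e0 s != 0.
  apply: contraNneq => /(congr1 (fun M : 'cV_(1 + n) => usubmx M 0 0)).
  by rewrite col_mxKu !mxE mulr1n => ->.
have sgnE (s : R) (x : 'rV[R]_(1 + n)) :
    (x *m e0 s) 0 0 = s * a x.
  rewrite [x in LHS]rowE mul_row_col mulmx0 addr0.
  by rewrite -scalar_mxM mxE mulr1n mulrC.
have [apos|/existsNP[p /not_implyP[Cp /negP]]] :=
    pselect (forall x, C x -> 0 <= a x).
  exists (e0 1); first exact: sgn_nz (oner_neq0 _).
  by move=> x Cx; rewrite sgnE mul1r apos.
rewrite -ltNge => ap_lt0.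
have [aneg|/existsNP[q /not_implyP[Cq /negP]]] :=
    pselect (forall x, C x -> a x <= 0).
  exists (e0 (-1)); first by apply: sgn_nz; rewrite oppr_eq0 oner_eq0.
  by move=> x Cx; rewrite sgnE mulN1r oppr_ge0 aneg.
rewrite -ltNge => aq_gt0.
pose D : set 'rV[R]_n := [set h | C (row_mx 0 h)].
(* Fourier-Motzkin: eliminating the first coordinate between two elements of C
   on opposite sides of the hyperplane a = 0 gives an element of the slice D. *)
have combD x y : C x -> C y -> a x < 0 -> 0 < a y ->
    D (a y *: rsubmx x - a x *: rsubmx y).
  move=> Cx Cy ax ay; rewrite /D /=.
  have -> : row_mx 0 (a y *: rsubmx x - a x *: rsubmx y) =
            a y *: (x : 'rV_(1 + n)) + (- a x) *: (y : 'rV_(1 + n)).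
    by rewrite !scaleE add_row_mx scaleNr mulNr mulrC -raddfD subrr raddf0.
  by apply: CD; apply: CZ => //; rewrite oppr_gt0.
have [||||f f0 fD] := IH D.
- by exists (a q *: rsubmx p - a p *: rsubmx q); exact: combD.
- by move=> x y Dx Dy; rewrite /D /= -[0]addr0 -add_row_mx; exact: CD.
- by move=> t x t0 Dx; rewrite /D /= -(scaler0 _ t) -scale_row_mx; exact: CZ.
- by rewrite /D /= row_mx0.
pose phi (x : 'rV[R]_(1 + n)) := (rsubmx x *m f) 0 0.
have key x y : C x -> C y -> a x < 0 -> 0 < a y ->
    - phi y / a y <= - phi x / a x.
  move=> Cx Cy ax ay; have := fD _ (combD _ _ Cx Cy ax ay).
  have -> : ((a y *: rsubmx x - a x *: rsubmx y) *m f) 0 0 =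
            a y * phi x - a x * phi y.
    by rewrite mulmxBl -!scalemxAl /phi !mxE.
  move=> h.
  rewrite ler_pdivrMr// mulrAC ler_ndivlMr//. lra.
(* Nonnegativity of [a x * l + phi x] bounds [l] below when [a x > 0] and above when [a x < 0]. By
   [key] every lower bound is at most every upper bound, so the supremum of the lower ones serves as
   [l]. *)
pose S := [set - phi x / a x | x in [set x | C x /\ 0 < a x]].
have Sq : S (- phi q / a q) by exists q.
have ubS x : C x -> a x < 0 -> ubound S (- phi x / a x).
  by move=> Cx ax _ [y [Cy ay] <-]; exact: key.
have supS : has_sup S.
  by split; [exists (- phi q / a q) | exists (- phi p / a p); exact: ubS].
pose l := sup S.
exists (col_mx l%:M f : 'cV[R]_(1 + n)).
  apply: contra_neq f0 => /(congr1 (fun M : 'cV_(1 + n) => dsubmx M)).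
  by rewrite col_mxKd linear0.
move=> x Cx.
have -> : (x *m (col_mx l%:M f : 'cV[R]_(1 + n))) 0 0 = a x * l + phi x.
  by rewrite {1}(rowE x) mul_row_col -scalar_mxM mxE [X in X + _]mxE mulr1n.
have [ax|ax|ax] := ltgtP (a x) 0.
- have : l <= - phi x / a x by apply: ge_sup; [case: supS | exact: ubS].
  by rewrite ler_ndivlMr//; nra.
- have : - phi x / a x <= l by apply: ub_le_sup; [case: supS | exists x].
  by rewrite ler_pdivrMr//; nra.
- rewrite ax mul0r add0r; apply: fD; rewrite /D /=.
  by have := Cx; rewrite {1}(rowE x) ax raddf0.
Qed.
End Separation.
(** * Norms on finite-dimensional spaces *)

Section Norms.
Context {R : realType}.

(** Expanding [x] in the standard basis, each coordinate is at most the max norm, so the sum of the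
    values of [p] on the basis is a valid constant. *)
Lemma seminorm_le_norm (n : nat) (p : 'rV[R]_n -> R) :
  (forall x y, p (x + y) <= p x + p y) ->
  (forall a x, p (a *: x) = `|a| * p x) ->
  exists2 C : R, 0 <= C & forall x, p x <= C * `|x|.
Proof.
move=> pD pZ.
have p0 : p 0 = 0 by rewrite -(scale0r 0) pZ normr0 mul0r.
have p_ge0 x : 0 <= p x.
  have := pD x (- x); rewrite subrr p0 -scaleN1r pZ normrN1 mul1r.
  by rewrite -mulr2n pmulrn_lge0.
exists (\sum_i p (delta_mx 0 i)); first exact: sumr_ge0.
move=> x; rewrite mulr_suml {1}(row_sum_delta x).
have /le_trans : p (\sum_j x 0 j *: delta_mx 0 j) <= \sum_j p (x 0 j *: delta_mx 0 j).
  apply: (big_ind2 (fun u v => p u <= v)) => [|u u' v v' h h'|//].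
    by rewrite p0.
  exact: le_trans (pD _ _) (lerD h h').
apply; apply: ler_sum => i _; rewrite pZ mulrC ler_wpM2l//.
rewrite [leRHS]/Num.norm /= mx_normrE.
exact: (le_bigmax _ (fun ij => `|x ij.1 ij.2|) (0, i)).
Qed.

Lemma continuous_le_seminorm (n : nat) (p f : 'rV[R]_n -> R) :
  (forall x y, p (x + y) <= p x + p y) ->
  (forall a x, p (a *: x) = `|a| * p x) ->
  (forall x y, `|f x - f y| <= p (x - y)) -> continuous f.
Proof.
move=> pD pZ fp; have [C C0 pC] := seminorm_le_norm pD pZ.
(* [C] may be zero, whereas [C + 1] can be divided by. *)
have C1 : 0 < C + 1 by rewrite ltr_wpDl.
move=> x; apply/(@cvgrPdist_le _ _ _ (nbhs x)) => /= e e0; near=> y.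
apply: (@le_trans _ _ ((C + 1) * `|x - y|)).
  apply: le_trans (fp x y) _; apply: le_trans (pC _) _.
  by rewrite mulrDl mul1r lerDl normr_ge0.
rewrite mulrC -ler_pdivlMr//; near: y.
have /cvgrPdist_le h := @cvg_id _ (nbhs x).
exact: (h _ (divr_gt0 e0 C1)).
Unshelve. all: by end_near. Qed.

Lemma seminorm_continuous (n : nat) (p : 'rV[R]_n -> R) :
  (forall x y, p (x + y) <= p x + p y) ->
  (forall a x, p (a *: x) = `|a| * p x) -> continuous p.
Proof.
move=> pD pZ; apply: (continuous_le_seminorm pD pZ) => x y.
have pB u v : p u - p v <= p (u - v).
  by rewrite lerBlDr; have := pD (u - v) v; rewrite subrK.
have pN u : p (- u) = p u by rewrite -scaleN1r pZ normrN1 mul1r.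
by rewrite ler_norml pB andbT lerNl opprB -[leRHS]pN opprB pB.
Qed.

Lemma linear_rV_continuous (n : nat) (f : 'rV[R]_n -> R) :
  (forall x y, f (x + y) = f x + f y) -> (forall a x, f (a *: x) = a * f x) ->
  continuous f.
Proof.
move=> fD fZ.
apply: (@continuous_le_seminorm _ (fun x => `|f x|)) => [x y|a x|x y].
- by rewrite fD ler_normD.
- by rewrite fZ normrM.
- by rewrite fD -(scaleN1r y) fZ mulN1r.
Qed.

(** Half of the equivalence of norms: the norm of [V], read in coordinates, is continuous and
    positive on the compact unit sphere of the max norm, and [c] is its minimum there. *)
Lemma r2v_norm_ge (V : finNormedModType R) :
  exists2 c : R, 0 < c & forall x : 'rV[R]_(dim V), c * `|x| <= `|r2v x : V|.
Proof.
pose p (x : 'rV[R]_(dim V)) := `|r2v x : V|.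
have pD x y : p (x + y) <= p x + p y by rewrite /p linearD ler_normD.
have pZ a x : p (a *: x) = `|a| * p x by rewrite /p linearZ normrZ.
have pc := seminorm_continuous pD pZ.
pose S := [set x : 'rV[R]_(dim V) | `|x| = 1].
(* In dimension zero the sphere is empty and any positive constant works. *)
have [x0|nx0] := pselect (forall x : 'rV[R]_(dim V), x = 0).
  by exists 1 => // x; rewrite (x0 x) normr0 mulr0.
have [x1 /eqP x1n0] : exists x : 'rV[R]_(dim V), x <> 0 by apply/existsNP.
have S0 : S !=set0.
  exists (`|x1|^-1 *: x1); rewrite /S /= normrZ normfV normr_id mulVf//.
  by rewrite normr_eq0.
have cS : compact S.
  apply: bounded_closed_compact.
    by exists 1; split => // M M1 x /= ->; exact: ltW.
  rewrite (_ : S = (fun x : 'rV[R]_(dim V) => `|x|) @^-1` [set 1]) //.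
  apply: preimage_closed; last exact: closed_eq.
  by move=> x _; exact: norm_continuous.
have [c /set_mem Sc minc] := EVT_min_rV S0 cS (continuous_subspaceT pc).
exists (p c) => [|x].
  rewrite /p normr_gt0; apply: contra_eq_neq (Sc : `|c| = 1).
  move=> /(congr1 v2r); rewrite r2vK linear0 => ->.
  by rewrite normr0 eq_sym oner_eq0.
have [->|xn0] := eqVneq x 0; first by rewrite normr0 mulr0.
have x0 : 0 < `|x| by rewrite normr_gt0.
have := minc (`|x|^-1 *: x); rewrite pZ normfV normr_id.
rewrite ler_pdivlMl// mulrC; apply; apply/mem_set.
by rewrite /S /= normrZ normfV normr_id mulVf// gt_eqF.
Qed.
End Norms.

(** * Operator norms and norming vectors *)

Section OperatorNorm.
Context {R : realType}.
Implicit Types U V W : finNormedModType R.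

Lemma hom_bounded U V (T : 'Hom(U, V)) :
  exists2 C : R, 0 <= C & forall u, `|T u| <= C * `|u|.
Proof.
pose p (x : 'rV[R]_(dim U)) := `|T (r2v x)|.
have [C C0 pC] : exists2 C : R, 0 <= C & forall x, p x <= C * `|x|.
  apply: seminorm_le_norm => [x y|a x]; first by rewrite /p !linearD ler_normD.
  by rewrite /p !linearZ normrZ.
have [c c0 cle] := r2v_norm_ge U.
exists (C / c); first by rewrite divr_ge0// ltW.
move=> u; have := pC (v2r u); rewrite /p v2rK => /le_trans; apply.
by rewrite -mulrA ler_wpM2l// ler_pdivlMl// -{2}(v2rK u).
Qed.

Lemma opnorm_ge0 U V (T : 'Hom(U, V)) : 0 <= opnorm T.
Proof.
have [C C0 TC] := hom_bounded T.
apply: ub_le_sup; last by exists 0; rewrite /= ?linear0 ?normr0 ?ler01.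
by exists C => _ [u /= u1 <-]; apply: le_trans (TC u) _; rewrite ler_piMr.
Qed.

Lemma le_opnorm U V (T : 'Hom(U, V)) u : `|T u| <= opnorm T * `|u|.
Proof.
have [C C0 TC] := hom_bounded T.
have [->|u0] := eqVneq u 0; first by rewrite linear0 !normr0 mulr0.
have nu0 : 0 < `|u| by rewrite normr_gt0.
rewrite -ler_pdivrMr//; apply: ub_le_sup.
  by exists C => _ [v /= v1 <-]; apply: le_trans (TC v) _; rewrite ler_piMr.
exists (`|u|^-1 *: u); first by rewrite /= normrZ normfV normr_id mulVf ?gt_eqF.
by rewrite linearZ normrZ normfV normr_id mulrC.
Qed.

Lemma opnorm_le U V (T : 'Hom(U, V)) (c : R) :
  0 <= c -> (forall u, `|T u| <= c * `|u|) -> opnorm T <= c.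
Proof.
move=> c0 Tc; apply: ge_sup; first by exists `|T 0|, 0; rewrite //= normr0.
by move=> _ [u /= u1 <-]; apply: le_trans (Tc u) _; rewrite ler_piMr.
Qed.

(** The unit ball is compact in coordinates, so [|f|] has a maximiser on it; a change of sign turns
    [|f|] into [f]. *)
Lemma opnorm_attained V (f : 'Hom(V, R^o)) :
  exists2 v : V, `|v| <= 1 & f v = opnorm f.
Proof.
pose S := [set x : 'rV[R]_(dim V) | `|r2v x : V| <= 1].
have S0 : S !=set0 by exists 0; rewrite /S /= linear0 normr0.
have [c c0 cle] := r2v_norm_ge V.
have cS : compact S.
  apply: bounded_closed_compact.
    exists c^-1; split; first by rewrite num_real.
    move=> M cM x /= Sx; apply: le_trans (ltW cM).
    by rewrite -[leRHS]mulr1 ler_pdivlMl//; exact: le_trans (cle x) Sx.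
  rewrite (_ : S = (fun x => `|r2v x : V|) @^-1` [set r | r <= 1]) //.
  apply: preimage_closed; last exact: closed_le.
  move=> x _; apply: seminorm_continuous => [y z|a y].
    by rewrite linearD ler_normD.
  by rewrite linearZ normrZ.
have fc : continuous (fun x : 'rV[R]_(dim V) => `|f (r2v x)|).
  apply: seminorm_continuous => [y z|a y]; first by rewrite !linearD ler_normD.
  by rewrite !linearZ normrZ.
have [x /set_mem Sx xmax] := EVT_max_rV S0 cS (continuous_subspaceT fc).
have fx : `|f (r2v x)| = opnorm f.
  apply/eqP; rewrite eq_le; apply/andP; split.
    by apply: le_trans (le_opnorm f _) _; rewrite ler_piMr ?opnorm_ge0.
  apply: ge_sup; first by exists `|f 0|, 0; rewrite //= normr0.
  move=> _ [u /= u1 <-]; have := xmax (v2r u); rewrite v2rK; apply.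
  by apply/mem_set; rewrite /S /= v2rK.
have [f0|f0] := leP 0 (f (r2v x) : R).
  by exists (r2v x) => //; rewrite -fx ger0_norm.
exists (- r2v x); first by rewrite normrN.
by rewrite linearN -fx ltr0_norm.
Qed.

Lemma lin_adjointE U V (T : 'Hom(U, V)) (v' : 'Hom(V, R^o)) u :
  lin_adjoint T v' u = v' (T u).
Proof. exact: comp_lfunE. Qed.

Lemma opnorm_eq0 U V (T : 'Hom(U, V)) u : opnorm T = 0 -> T u = 0.
Proof.
by move=> T0; apply/eqP; rewrite -normr_le0 -(mul0r `|u|) -T0 le_opnorm.
Qed.

End OperatorNorm.

(** * Linear functionals and their coordinates *)

Section Forms.
Context {R : realType} {V : finNormedModType R}.
Implicit Types (f : 'Hom(V, R^o)) (u v : V).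

Lemma functionalD f u v : f (u + v) = f u + f v :> R.
Proof. exact: linearD. Qed.

Lemma functionalN f u : f (- u) = - f u :> R.
Proof. exact: linearN. Qed.

Lemma functionalZ f a u : f (a *: u) = a * f u :> R.
Proof. exact: linearZ. Qed.

Lemma functional_sum f (I : finType) (u : I -> V) :
  f (\sum_i u i) = \sum_i (f (u i) : R) :> R.
Proof. exact: linear_sum. Qed.

End Forms.

Section Functionals.
Context {R : realType}.
Implicit Types U V : finNormedModType R.

(** The witness lives in a [sig] type so that [sval] can extract it, also for families indexed by
    [i]. *)
Lemma hom_of_linear U V (g : U -> V) :
  (forall a u v, g (a *: u + v) = a *: g u + g v) ->
  {f : 'Hom(U, V) | forall u, f u = g u}.
Proof.
move=> glin; pose gL := GRing.isLinear.Build R U V *:%R g glin.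
pose g' : {linear U -> V} := HB.pack g gL.
by exists (linfun g') => u; rewrite (lfunE g').
Qed.

Fact coform_linear V (a : 'cV[R]_(dim V)) c u v :
  (v2r (c *: u + v) *m a) 0 0 = c * (v2r u *m a) 0 0 + (v2r v *m a) 0 0.
Proof.
by rewrite linearD linearZ mulmxDl -scalemxAl [LHS]mxE [X in X + _]mxE.
Qed.

(** Turns a coefficient column, as produced by [cone_separation], into an element of the dual
    space. *)
Definition coform V (a : 'cV[R]_(dim V)) : 'Hom(V, R^o) :=
  sval (@hom_of_linear V R^o (fun v => (v2r v *m a) 0 0) (coform_linear a)).

Lemma coformE V (a : 'cV[R]_(dim V)) v : coform a v = (v2r v *m a) 0 0.
Proof. by rewrite /coform; case: hom_of_linear. Qed.

Lemma coform_eq0 V (a : 'cV[R]_(dim V)) : (forall v, coform a v = 0) -> a = 0.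
Proof.
move=> a0; apply/colP => i; have := a0 (r2v (delta_mx 0 i)).
by rewrite coformE r2vK -rowE !mxE.
Qed.

Lemma coform_hom V (f : 'Hom(V, R^o)) :
  coform (\col_i (f (r2v (delta_mx 0 i)) : R)) = f.
Proof.
apply/lfunP => v.
rewrite coformE mxE -[in RHS](v2rK v) [in RHS](row_sum_delta (v2r v)).
rewrite !linear_sum; apply: eq_bigr => i _.
by rewrite !linearZ mxE.
Qed.

End Functionals.

(** Letting [t] tend to 0 gives the claim. It removes the positive parameters that keep 0 out of a
    cone before separation. *)
Lemma ge0_perturbed {R : realType} (a c : R) :
  (forall t, 0 < t -> 0 <= a + t * c) -> 0 <= a.
Proof.
move=> h; apply/ler_addgt0Pr => e e0.
have c1 : 0 < `|c| + 1 by rewrite ltr_wpDl.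
have := h (e / (`|c| + 1)) (divr_gt0 e0 c1).
move=> /le_trans; apply; rewrite lerD2l mulrAC ler_pdivrMr// ler_pM2l//.
by rewrite (le_trans (ler_norm c))// lerDl ler01.
Qed.

(** * Sublinear mappings and their perturbations *)

Section SublinearMappings.
Context {R : realType} {X Y : finNormedModType R} {F : X -> set Y}.
Hypothesis F_sublinear : sublinear F.

Lemma sublinear0 : F 0 0.
Proof.
have [[[[x y] Fxy] FZ] _] := F_sublinear.
by have := FZ 0 (x, y) (lexx 0) Fxy; rewrite /sv_graph /= !scale0r.
Qed.

Lemma sublinearZ t x y : 0 <= t -> F x y -> F (t *: x) (t *: y).
Proof.
by move=> t0 Fxy; have [[_ FZ] _] := F_sublinear; exact: (FZ t (x, y)).
Qed.

(** The sum is twice the midpoint supplied by convexity. *)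
Lemma sublinearD x y x' y' : F x y -> F x' y' -> F (x + x') (y + y').
Proof.
move=> Fxy Fxy'; have [_ Fconv] := F_sublinear.
have half : 1 - 2^-1 = 2^-1 :> R by lra.
have h_ge0 : 0 <= 2^-1 :> R by rewrite invr_ge0.
have h_le1 : 2^-1 <= 1 :> R by rewrite invf_le1 ?ler1n.
have h : F (2^-1 *: x + (1 - 2^-1) *: x') (2^-1 *: y + (1 - 2^-1) *: y').
  exact: set_mem (Fconv (x, y) (x', y') (Itv01 h_ge0 h_le1)
    (mem_set Fxy) (mem_set Fxy')).
have := sublinearZ (ler0n R 2) h.
by rewrite half -!scalerDr !scalerA divff ?pnatr_eq0// !scale1r.
Qed.

(** A functional nonnegative on all of [Y] vanishes, which gives one direction. For the other, a
    missed value [b] is separated from the range of [F + G], itself a convex cone. *)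
Lemma nonsurjectiveP (G : 'Hom(X, Y)) :
  ~ sv_surjective (sv_add F G) <->
  exists2 y' : 'Hom(Y, R^o), y' <> 0 &
    forall x y, F x y -> 0 <= (y' (y + G x) : R).
Proof.
split=> [nsurj|[y' y'0 y'F] surj]; last first.
  apply: y'0; apply/lfunP => y; rewrite zero_lfunE.
  have ge0 z : 0 <= (y' z : R).
    have : (\bigcup_(x in setT) sv_add F G x) z by rewrite surj.
    by case=> x _ [w Fxw <-]; exact: y'F.
  apply/eqP; rewrite eq_le ge0 andbT.
  by have := ge0 (- y); rewrite linearN oppr_ge0.
have [b nb] : exists b, ~ exists x y, F x y /\ y + G x = b.
  apply/existsNP => all_b; apply: nsurj; apply/seteqP; split=> // b _.
  by have [x [y [Fxy <-]]] := all_b b; exists x => //; exists y.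
(* With [t > 0] this cone misses 0, since dividing [y + G x = t *: b] by [t] would reach [b]. *)
pose D : set 'rV[R]_(dim Y) := [set e | exists x y t,
  [/\ F x y, 0 < t & e = v2r (y + G x - t *: b)]].
have [||||a a0 aD] := @cone_separation _ _ D.
- by exists (v2r (0 + G 0 - 1 *: b)), 0, 0, 1; split => //; exact: sublinear0.
- move=> _ _ [x [y [t [Fxy t0 ->]]]] [x' [y' [t' [Fxy' t0' ->]]]].
  exists (x + x'), (y + y'), (t + t').
  split; [exact: sublinearD | exact: addr_gt0 |].
  rewrite -linearD; congr v2r.
  by rewrite linearD scalerDl opprD addrACA (addrACA y).
- move=> c _ c0 [x [y [t [Fxy t0 ->]]]].
  exists (c *: x), (c *: y), (c * t).
  split; [exact/sublinearZ/Fxy/ltW | exact: mulr_gt0 |].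
  rewrite -linearZ; congr v2r.
  by rewrite scalerBr scalerDr scalerA [in RHS]linearZ.
- case=> [x [y [t [Fxy t0 /esym/(congr1 r2v)]]]].
  rewrite v2rK linear0 => /eqP; rewrite subr_eq0 => /eqP e; apply: nb.
  exists (t^-1 *: x), (t^-1 *: y); split.
    by apply: sublinearZ => //; rewrite invr_ge0 ltW.
  by rewrite linearZ -scalerDr e scalerA mulVf ?scale1r ?gt_eqF.
exists (coform a).
  move=> a0'; move/eqP: a0; apply; apply: coform_eq0 => v.
  by rewrite a0' zero_lfunE.
move=> x y Fxy; apply: (@ge0_perturbed _ _ (- coform a b : R)) => t t0.
have /aD : D (v2r (y + G x - t *: b)) by exists x, y, t.
by rewrite -coformE linearB linearZ mulrN.
Qed.

End SublinearMappings.

(* [Defs.ratio] is qualified because MathComp's fractions also define [ratio]. *)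
Section Ratio.
Context {R : realType}.
Implicit Types z n r : R.

(** The division conventions make this hold for [n = 0] too: both sides then say that [z]
    vanishes. *)
Lemma ratio_le z n r : 0 <= z -> 0 <= n -> 0 <= r ->
  (Defs.ratio z n <= r%:E)%E = (z <= r * n).
Proof.
move=> z0 n0 r0; rewrite /Defs.ratio; have [->|nn0] := eqVneq n 0.
  have [->|zn0] := eqVneq z 0; first by rewrite mulr0 lee_fin r0 lexx.
  rewrite mulr0 leye_eq; apply/esym/negbTE.
  by rewrite -ltNge lt_neqAle eq_sym zn0.
by rewrite lee_fin ler_pdivrMr// lt_neqAle eq_sym nn0.
Qed.

Lemma ratio_gt z n r : 0 <= z -> 0 <= n -> 0 <= r ->
  (r%:E < Defs.ratio z n)%E = (r * n < z).
Proof. by move=> z0 n0 r0; rewrite !ltNge ratio_le. Qed.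

Lemma ratio_ge0 z n : 0 <= z -> 0 <= n -> (0 <= Defs.ratio z n)%E.
Proof.
move=> z0 n0; rewrite /Defs.ratio.
case: ifPn => _; last by rewrite lee_fin divr_ge0.
by case: ifPn => // _; rewrite leey.
Qed.

End Ratio.

(** * Feasible radii and the first three quantities *)

Section Feasible.
Context {R : realType} {k : nat} {X Y : finNormedModType R}.
Context {U V : 'I_k -> finNormedModType R}.
Variables (F : X -> set Y).
Hypothesis F_sublinear : sublinear F.
Variables (P : forall i, 'Hom(V i, Y)) (Q : forall i, 'Hom(X, U i)).

(** Each product of a scalar [z i] and a functional [u' i] is merged into one functional [m i], and
    the norm bound is multiplied out, so that no division by a vanishing norm occurs. *)
Definition feasible (r : R) :=
  exists (y' : 'Hom(Y, R^o)) (m : forall i, 'Hom(U i, R^o)),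
  [/\ y' <> 0,
      forall i u, `|m i u| <= r * opnorm (lin_adjoint (P i) y') * `|u| &
      forall x y, F x y -> \sum_i (m i (Q i x) : R) <= (y' y : R)].

Lemma nonsurjective_perturbedP (T : forall i, 'Hom(U i, V i)) :
  ~ sv_surjective (perturbed F P Q T) <->
  exists2 y' : 'Hom(Y, R^o), y' <> 0 &
    forall x y, F x y -> - \sum_i (y' (P i (T i (Q i x))) : R) <= (y' y : R).
Proof.
rewrite /perturbed; set G := \sum_(i < k) _.
have GE (y' : 'Hom(Y, R^o)) x : y' (G x) =
    \sum_i (y' (P i (T i (Q i x))) : R).
  rewrite sum_lfunE functional_sum.
  by apply: eq_bigr => i _; rewrite !comp_lfunE.
split.
  move=> /(nonsurjectiveP F_sublinear)[y' y'0 H]; exists y' => // x y Fxy.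
  by have := H x y Fxy; rewrite functionalD GE addrC -lerBlDl sub0r.
case=> y' y'0 H; apply/(nonsurjectiveP F_sublinear); exists y' => // x y Fxy.
by rewrite functionalD GE addrC -lerBlDl sub0r; exact: H.
Qed.

Lemma feasible_of_linear (t : \bar R) : linear_values F P Q t ->
  exists r, [/\ 0 <= r, t = r%:E & feasible r].
Proof.
case=> T [/nonsurjective_perturbedP[y' y'0 H] ->].
set r := \big[_/_]_(_ < _) _; exists r; split => //.
  rewrite /r; elim/big_ind : _ => [//|x y x0 y0|i _].
    by rewrite le_max x0.
  exact: opnorm_ge0.
exists y', (fun i => - (lin_adjoint (P i) y' \o T i)%VF); split => //.
- move=> i u; rewrite opp_lfunE normrN comp_lfunE.
  apply: le_trans (le_opnorm _ _) _; rewrite [r * _]mulrC -mulrA.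
  rewrite ler_wpM2l ?opnorm_ge0//; apply: le_trans (le_opnorm _ _) _.
  by rewrite ler_wpM2r//; exact: le_bigmax.
- move=> x y Fxy; apply: le_trans (H x y Fxy); rewrite -sumrN.
  by apply: ler_sum => i _; rewrite opp_lfunE comp_lfunE lin_adjointE.
Qed.

(** The rank-one maps are built so that [y' (P i (T i u)) = - m i u]; the same [y'] then witnesses
    nonsurjectivity. *)
Lemma feasible_rank_one (r : R) : 0 <= r -> feasible r ->
  exists2 t, rank_one_values F P Q t & (t <= r%:E)%E.
Proof.
move=> r0 [y' [m [y'0 mle H]]].
pose N i := opnorm (lin_adjoint (P i) y').
have N0 i : 0 <= N i by exact: opnorm_ge0.
have vex i : {v : V i | `|v| <= 1 /\ lin_adjoint (P i) y' v = N i}.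
  apply: cid; have [v v1 vN] := opnorm_attained (lin_adjoint (P i) y').
  by exists v.
pose v i := sval (vex i).
have v1 i : `|v i| <= 1 by rewrite /v; case: (vex i) => ? [].
have vN i : lin_adjoint (P i) y' (v i) = N i.
  by rewrite /v; case: (vex i) => ? [].
(* When [N i = 0] the inverse is 0 by convention and [T i] vanishes; this is consistent because
   [mle] then forces [m i = 0]. *)
pose u' i : 'Hom(U i, R^o) := - (N i)^-1 *: m i.
have u'E i u : u' i u = - ((N i)^-1 * (m i u : R)) :> R.
  by rewrite scale_lfunE -mulNr.
have Tex i : {T : 'Hom(U i, V i) | forall u, T u = (u' i u : R) *: v i}.
  by apply: hom_of_linear => a u w; rewrite linearP scalerDl scalerA.
pose T i := sval (Tex i).
have TE i u : T i u = (u' i u : R) *: v i by rewrite /T; case: (Tex i).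
exists (\big[Num.max/0]_(i < k) opnorm (T i))%:E.
  exists T; split => //; first by move=> i; exists (u' i), (v i).
  apply/nonsurjective_perturbedP; exists y' => // x y Fxy.
  apply: le_trans (H x y Fxy); rewrite -sumrN; apply: ler_sum => i _.
  have -> : y' (P i (T i (Q i x))) = (u' i (Q i x) : R) * N i.
    by rewrite TE linearZ /= functionalZ -(lin_adjointE (P i)) vN.
  rewrite u'E mulNr opprK.
  have [Ni0|Ni0] := eqVneq (N i) 0; last by rewrite mulrAC mulVf// mul1r.
  rewrite Ni0 mulr0; have := mle i (Q i x).
  by rewrite -/(N i) Ni0 mulr0 mul0r normr_le0 => /eqP ->.
rewrite lee_fin; apply/bigmax_leP; split => // i _; apply: opnorm_le => // u.
rewrite TE normrZ u'E normrN normrM normfV (ger0_norm (N0 i)).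
have [Ni0|Ni0] := eqVneq (N i) 0; first by rewrite Ni0 invr0 !mul0r mulr_ge0.
apply: (@le_trans _ _ ((N i)^-1 * `|m i u|)).
  apply: ler_piMr; last exact: v1.
  by apply: mulr_ge0; rewrite ?invr_ge0 ?N0 ?normr_ge0.
rewrite ler_pdivrMl ?lt_neqAle ?(eq_sym 0) ?Ni0 ?N0//.
by rewrite mulrA [N i * r]mulrC mle.
Qed.

Lemma rank_one_linear : rank_one_values F P Q `<=` linear_values F P Q.
Proof. by move=> t [T [_ Tns ->]]; exists T. Qed.

Lemma dual_values_ge0 t : dual_values F P Q t -> (0 <= t)%E.
Proof.
case=> u' [z [y' [_ z0 _ _ ->]]]; elim/big_ind: _ => // [x y x0 y0|i _].
  by rewrite le_max x0.
exact: ratio_ge0 (z0 i) (opnorm_ge0 _).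
Qed.

Lemma feasible_of_dual (r : R) : dual_values F P Q r%:E -> feasible r.
Proof.
move=> Dr; have r0 : 0 <= r by rewrite -lee_fin dual_values_ge0.
case: Dr => u' [z [y' [u1 z0 y'0 H rE]]].
exists y', (fun i => z i *: u' i); split => //.
- move=> i u; rewrite scale_lfunE normrM (ger0_norm (z0 i)).
  apply: (@le_trans _ _ (z i * `|u|)).
    rewrite ler_wpM2l//; apply: le_trans (le_opnorm _ _) _.
    by rewrite ler_piMl.
  rewrite ler_wpM2r// -ratio_le ?opnorm_ge0// rE.
  exact: (le_bigmax _
    (fun i => Defs.ratio (z i) (opnorm (lin_adjoint (P i) y')))).
- move=> x y Fxy; apply: le_trans (H x y Fxy); rewrite sum_lfunE.
  by apply: ler_sum => i _; rewrite !scale_lfunE lin_adjointE.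
Qed.

Lemma feasible_dual (r : R) : 0 <= r -> feasible r ->
  exists2 t, dual_values F P Q t & (t <= r%:E)%E.
Proof.
move=> r0 [y' [m [y'0 mle H]]].
exists (\big[maxe/0%E]_(i < k)
              Defs.ratio (opnorm (m i)) (opnorm (lin_adjoint (P i) y'))); last first.
  apply/bigmax_leP; split; first by rewrite lee_fin.
  move=> i _; rewrite ratio_le ?opnorm_ge0//; apply: opnorm_le => //.
  by rewrite mulr_ge0 ?opnorm_ge0.
(* Each [m i] is split into its norm and a normalised functional; if [m i = 0], the inverse is 0 and
   both factors vanish. *)
exists (fun i => (opnorm (m i))^-1 *: m i), (fun i => opnorm (m i)), y'.
split => //.
- move=> i; apply: opnorm_le => // u; rewrite scale_lfunE normrM normfV.
  rewrite (ger0_norm (opnorm_ge0 _)) mul1r.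
  have [m0|m0] := eqVneq (opnorm (m i)) 0; first by rewrite m0 invr0 mul0r.
  by rewrite ler_pdivrMl ?le_opnorm// lt_neqAle eq_sym m0 opnorm_ge0.
- by move=> i; exact: opnorm_ge0.
- move=> x y Fxy; apply: le_trans (H x y Fxy); rewrite sum_lfunE.
  apply: ler_sum => i _; rewrite scale_lfunE lin_adjointE scale_lfunE.
  have [m0|m0] := eqVneq (opnorm (m i)) 0; last first.
    by rewrite scalerA divff// scale1r.
  by rewrite (opnorm_eq0 _ m0) m0 !scale0r.
Qed.

End Feasible.

(** * Feasible radii and the fourth quantity *)

Section Primal.
Context {R : realType} {k : nat} {X Y : finNormedModType R}.
Context {U V : 'I_k -> finNormedModType R}.
Variables (F : X -> set Y).
Hypothesis F_sublinear : sublinear F.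
Variables (P : forall i, 'Hom(V i, Y)) (Q : forall i, 'Hom(X, U i)).

(** A competitor of value above [r] satisfies [w i > r * |Q i x|] for all [i]. Evaluating [y'] on it
    gives a sum of nonnegative terms that is at most 0, so every [N i] vanishes, and surjectivity of
    [F] is contradicted. *)
Lemma feasible_primal (r : R) : sv_surjective F -> 0 <= r -> feasible F P Q r ->
  exists2 t, primal_values F P Q t & (t <= r%:E)%E.
Proof.
move=> F_surj r0 [y' [m [y'0 mle H]]].
pose N i := opnorm (lin_adjoint (P i) y').
have N0 i : 0 <= N i by exact: opnorm_ge0.
have vex i : {v : V i | `|v| <= 1 /\ lin_adjoint (P i) y' v = N i}.
  apply: cid; have [v v1 vN] := opnorm_attained (lin_adjoint (P i) y').
  by exists v.
(* The sign makes [y' (P i (v i))] as small as the unit ball permits. *)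
pose v i := - sval (vex i).
have v1 i : `|v i| <= 1 by rewrite normrN; case: (vex i) => ? [].
have vN i : y' (P i (v i)) = - N i :> R.
  rewrite linearN /= functionalN -(lin_adjointE (P i)).
  by case: (vex i) => ? [] _ /= ->.
eexists; first by exists v.
apply: ge_ereal_sup => _ [->|[x [w [w0 Fxw ->]]]]; first by rewrite lee_fin.
rewrite leNgt; apply/negP => lt_r.
have wr i : r * `|Q i x| < w i.
  rewrite -(ratio_gt (ltW (w0 i)) (normr_ge0 _) r0); apply: lt_le_trans lt_r _.
  exact: bigmin_le_cond.
have sum_le : \sum_i (w i - r * `|Q i x|) * N i <= 0.
  have := H _ _ Fxw; rewrite functional_sum -subr_le0 -sumrB; apply: le_trans.
  apply: ler_sum => i _; rewrite functionalZ vN mulrN opprK mulrBl addrC lerD2r.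
  have := mle i (Q i x); rewrite ler_norml -/(N i) => /andP[+ _].
  by rewrite mulrAC.
have term_ge0 i : 0 <= (w i - r * `|Q i x|) * N i.
  by rewrite mulr_ge0 ?N0// subr_ge0 ltW.
have Nz i : N i = 0.
  have : (w i - r * `|Q i x|) * N i <= 0.
    by apply: le_trans sum_le; rewrite (bigD1 i)//= lerDl sumr_ge0.
  rewrite pmulr_rle0 ?subr_gt0// => N_le0.
  by apply/eqP; rewrite eq_le N0 andbT.
(* With all [N i] zero the functionals [m i] vanish, so [y'] is nonnegative on the range of [F]
   itself. *)
have : ~ sv_surjective (sv_add F 0).
  apply/(nonsurjectiveP F_sublinear); exists y' => // a b Fab.
  rewrite zero_lfunE addr0; apply: le_trans (H _ _ Fab); apply: sumr_ge0 => i _.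
  have := mle i (Q i a); rewrite -/(N i) Nz mulr0 mul0r normr_le0 => /eqP ->.
  exact: lexx.
apply; rewrite /sv_surjective -[RHS]F_surj; apply: eq_bigcupr => a _.
apply/seteqP; split => [_ [b Fab <-]|b Fab]; first by rewrite zero_lfunE addr0.
by exists b => //; rewrite zero_lfunE addr0.
Qed.

(** A point of [Y] and a family of points of the [U i] are packed into one row, so that
    [cone_separation] applies; [pack_form] splits the separating column back into functionals on the
    factors. *)
Let n := (dim Y + \sum_i dim (U i))%N.
Let pack (y : Y) (p : forall i, U i) : 'rV[R]_n :=
  row_mx (v2r y) (\mxrow_i v2r (p i)).

Let packD y y' p p' :
  pack y p + pack y' p' = pack (y + y') (fun i => p i + p' i).
Proof.
rewrite /pack add_row_mx linearD; congr row_mx; rewrite -mxrowD.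
by apply: eq_mxrow => i; rewrite linearD.
Qed.

Let packZ a y p : a *: pack y p = pack (a *: y) (fun i => a *: p i).
Proof.
rewrite /pack scale_row_mx linearZ; congr row_mx.
apply/rowP => j; rewrite !mxE linearZ !mxE.
by [].
Qed.

Let pack_form (a : 'cV[R]_n) y p : (pack y p *m a) 0 0 =
  (coform (usubmx a) y : R) + \sum_i (coform (submxcol (dsubmx a) i) (p i) : R).
Proof.
rewrite -{1}(vsubmxK a) /pack mul_row_col mxE -coformE; congr (_ + _).
rewrite -{1}(submxcolK (dsubmx a)) mul_mxrow_mxcol summxE.
by apply: eq_bigr => i _; rewrite coformE.
Qed.

(** The separating pair [(y', m)] is tested twice: at [x = 0], [y = 0] it yields the norm bounds on
    the [m i], and at [p = 0] it yields the adjoint inequality for [- m i]. *)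
Lemma feasible_of_primal_bound (v : forall i, V i) (s : R) : 0 <= s ->
  (forall i, `|v i| <= 1) ->
  (forall x w, F x (\sum_i w i *: P i (v i)) ->
    ~ (forall i, s * `|Q i x| < w i)) ->
  feasible F P Q s.
Proof.
move=> s0 v1 Hs.
(* The slack [p i] stands for [- Q i x]: if 0 lies in [D], then [Q i x = - p i] and [x], [w] violate
   [Hs]. *)
pose D : set 'rV[R]_n := [set e | exists x y w p,
  [/\ F x y, forall i : 'I_k, s * `|p i| < w i &
      e = pack (y - \sum_i w i *: P i (v i)) (fun i => Q i x + p i)]].
have [||||a a0 aD] := @cone_separation _ _ D.
- eexists; exists 0, 0, (fun=> 1), (fun=> 0).
  split; [exact: sublinear0 | | by []].
  by move=> i; rewrite normr0 mulr0.
- move=> _ _ [x [y [w [p [Fxy wp ->]]]]] [x' [y' [w' [p' [Fxy' wp' ->]]]]].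
  exists (x + x'), (y + y'), (fun i => w i + w' i), (fun i => p i + p' i).
  split.
  + exact: sublinearD.
  + move=> i; apply: le_lt_trans (ltrD (wp i) (wp' i)).
    by rewrite -mulrDr ler_wpM2l// ler_normD.
  + rewrite packD; congr pack.
      rewrite addrACA -opprD -big_split /=; congr (_ - _).
      by apply: eq_bigr => i _; rewrite scalerDl.
    by apply: functional_extensionality_dep => i; rewrite linearD addrACA.
- move=> c _ c0 [x [y [w [p [Fxy wp ->]]]]].
  exists (c *: x), (c *: y), (fun i => c * w i), (fun i => c *: p i); split.
  + by apply: sublinearZ => //; exact: ltW.
  + by move=> i; rewrite normrZ gtr0_norm// mulrCA ltr_pM2l//; exact: wp.
  + rewrite packZ; congr pack.
      rewrite scalerBr scaler_sumr; congr (_ - _).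
      by apply: eq_bigr => i _; rewrite scalerA.
    by apply: functional_extensionality_dep => i; rewrite linearZ scalerDr.
- case=> x [y [w [p [Fxy wp /esym e0]]]].
  have y0 : y = \sum_i w i *: P i (v i).
    apply/eqP; rewrite -subr_eq0; apply/eqP/v2r_inj.
    by have := congr1 lsubmx e0; rewrite row_mxKl !linear0.
  have p0 i : Q i x = - p i.
    apply/eqP; rewrite -subr_eq0 opprK; apply/eqP/v2r_inj; rewrite linear0.
    have := congr1 (fun M => submxrow (rsubmx M) i) e0.
    by rewrite row_mxKr mxrowK linear0 submxrow0.
  by apply: (Hs x w); [rewrite -y0 | move=> i; rewrite p0 normrN].
pose y' := coform (usubmx a).
pose m i := coform (submxcol (dsubmx a) i).
pose A i : R := y' (P i (v i)).
(* The weights [w i = s * |p i| + t] are admissible for [t > 0]; then [t] tends to 0. *)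
have key x y p : F x y ->
    0 <= (y' y : R) - \sum_i s * `|p i| * A i + \sum_i (m i (Q i x + p i) : R).
  move=> Fxy; apply: (@ge0_perturbed _ _ (- \sum_i A i)) => t t0.
  pose w i := s * `|p i| + t.
  have /aD : D (pack (y - \sum_i w i *: P i (v i)) (fun i => Q i x + p i)).
    by exists x, y, w, p; split => // i; rewrite ltrDl.
  rewrite pack_form -/y' functionalD functionalN functional_sum.
  have -> : \sum_i (y' (w i *: P i (v i)) : R) =
            \sum_i s * `|p i| * A i + t * \sum_i A i.
    rewrite mulr_sumr -big_split; apply: eq_bigr => i _ /=.
    by rewrite functionalZ mulrDl.
  by rewrite mulrN [X in _ -> 0 <= X]addrAC opprD addrA.
have F0 := sublinear0 F_sublinear.
(* The family equal to [u] at index [i] and to 0 elsewhere isolates the single functional [m i]. *)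
pose single i (u : U i) j : U j := dfwith (fun j => 0 : U j) i u j.
have single_sum i u (f : forall j, U j -> R) : (forall j, f j 0 = 0) ->
    \sum_j f j (single i u j) = f i u.
  move=> f0; rewrite (bigD1 i)//= /single dfwithin big1 ?addr0// => j ji.
  by rewrite dfwithout 1?eq_sym.
have key0 p : \sum_i s * `|p i| * A i <= \sum_i (m i (p i) : R).
  have := key 0 0 p F0; rewrite linear0 sub0r addrC subr_ge0.
  by move=> /le_trans; apply; apply: ler_sum => i _; rewrite linear0 add0r.
have m_ge i u : s * `|u| * A i <= (m i u : R).
  have := key0 (single i u).
  rewrite (single_sum i u (fun j z => s * `|z| * A j)); last first.
    by move=> j; rewrite normr0 mulr0 mul0r.
  by rewrite (single_sum i u (fun j z => m j z : R))// => j; rewrite linear0.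
have A_le i : `|A i| <= opnorm (lin_adjoint (P i) y').
  rewrite /A -(lin_adjointE (P i)); apply: le_trans (le_opnorm _ _) _.
  by apply: ler_piMr; [exact: opnorm_ge0 | exact: v1].
exists y', (fun i => - m i); split.
(* If [y' = 0], then every [A i] is 0, so each [m i] is nonnegative and hence zero; the whole
   separating column would vanish. *)
- move=> y'0; move/eqP: a0; apply.
  have A0 i : A i = 0 by rewrite /A y'0 zero_lfunE.
  have m0 i u : m i u = 0 :> R.
    have ge0 z : 0 <= (m i z : R) by have := m_ge i z; rewrite A0 mulr0.
    by apply/eqP; rewrite eq_le ge0 andbT -oppr_ge0 -functionalN ge0.
  rewrite -(vsubmxK a) -(submxcolK (dsubmx a)).
  rewrite (coform_eq0 (a := usubmx a)) => [|z]; last first.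
    by rewrite -/y' y'0 zero_lfunE.
  by rewrite (eq_mxcol (fun i => coform_eq0 (m0 i))) mxcol0 col_mx0.
- move=> i u; rewrite opp_lfunE normrN mulrAC.
  have bound z : - (s * `|z| * opnorm (lin_adjoint (P i) y')) <= (m i z : R).
    apply: le_trans (m_ge i z); rewrite -mulrN ler_wpM2l ?mulr_ge0//.
    by have := A_le i; rewrite ler_norml => /andP[].
  rewrite ler_norml bound /= -lerN2 -functionalN.
  by have := bound (- u); rewrite normrN.
- move=> x y Fxy; have := key x y (fun=> 0) Fxy.
  rewrite [X in _ - X + _]big1 ?subr0 => [|i _]; last first.
    by rewrite normr0 mulr0 mul0r.
  rewrite addrC -lerBlDl sub0r; apply: le_trans; rewrite -sumrN.
  by apply: ler_sum => i _; rewrite opp_lfunE addr0.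
Qed.

Lemma primal_values_ge0 t : primal_values F P Q t -> (0 <= t)%E.
Proof. by case=> v [_ ->]; apply: ereal_sup_ubound; left. Qed.

Lemma feasible_of_primal (s : R) : primal_values F P Q s%:E -> feasible F P Q s.
Proof.
move=> Ps; have s0 : 0 <= s by rewrite -lee_fin primal_values_ge0.
case: Ps => v [v1 sE]; apply: (feasible_of_primal_bound s0 v1) => x w Fxw wQ.
have w0 i : 0 < w i by apply: le_lt_trans (wQ i); rewrite mulr_ge0.
(* A minimum of finitely many ratios above [s] is still above [s], yet the supremum of such minima
   is [s]. *)
suff : (s%:E < s%:E)%E by rewrite ltxx.
rewrite [X in (_ < X)%E]sE.
apply: (@lt_le_trans _ _ (\big[mine/+oo%E]_(i < k) Defs.ratio (w i) `|Q i x|)).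
  apply: lt_bigmin => [|i _]; first exact: ltry.
  by rewrite ratio_gt// ltW.
by apply: ereal_sup_ubound; right; exists x, w.
Qed.

End Primal.

(** * Existence of the least feasible radius *)

Section Minimum.
Context {R : realType} {k : nat} {X Y : finNormedModType R}.
Context {U V : 'I_k -> finNormedModType R}.
Variables (F : X -> set Y).
Variables (P : forall i, 'Hom(V i, Y)) (Q : forall i, 'Hom(X, U i)).

Let n := (dim Y + \sum_i dim (U i))%N.
(** Coordinates are kept in rows, where compactness is used, while [coform] takes columns; hence the
    transposes. *)
Let functional_of (a : 'rV[R]_n) : 'Hom(Y, R^o) := coform (lsubmx a)^T.
Let multiplier_of (a : 'rV[R]_n) i : 'Hom(U i, R^o) :=
  coform (submxrow (rsubmx a) i)^T.

(* The radius r and the coordinates of (y', m) are stored in a single row, so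
   that compactness of bounded closed sets of rows applies. *)
Let constraints : set 'rV[R]_(1 + n) := [set e : 'rV[R]_(1 + n) |
  let r := lsubmx e 0 0 in let a : 'rV[R]_n := rsubmx e in
  [/\ 0 <= r,
      `|lsubmx a| = 1,
      forall i u, `|multiplier_of a i u| <=
                  r * opnorm (lin_adjoint (P i) (functional_of a)) * `|u| &
      forall x y, F x y ->
        \sum_i (multiplier_of a i (Q i x) : R) <= (functional_of a y : R)]].

(** The norm of [P_i^* y'] as a function of the coordinates of [y']. Being a seminorm, it is
    continuous, which serves closedness, and bounded by a multiple of the norm, which serves
    compactness. *)
Let adjoint_seminorm i (y : 'rV[R]_(dim Y)) : R :=
  opnorm (lin_adjoint (P i) (coform y^T)).

Let coform_trD (y y' : 'rV[R]_(dim Y)) z :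
  coform (y + y')^T z = coform y^T z + coform y'^T z :> R.
Proof. by rewrite !coformE linearD mulmxDr mxE. Qed.

Let coform_trZ c (y : 'rV[R]_(dim Y)) z :
  coform (c *: y)^T z = c * coform y^T z :> R.
Proof. by rewrite !coformE linearZ /= -scalemxAr mxE. Qed.

Let adjoint_seminormD i y y' :
  adjoint_seminorm i (y + y') <= adjoint_seminorm i y + adjoint_seminorm i y'.
Proof.
apply: opnorm_le => [|v]; first by rewrite addr_ge0 ?opnorm_ge0.
rewrite lin_adjointE coform_trD mulrDl; apply: le_trans (ler_normD _ _) _.
by rewrite -!lin_adjointE lerD ?le_opnorm.
Qed.

(** The inequality [Zle] for all scalars, applied to the inverse of [c], gives the reverse one. *)
Let adjoint_seminormZ i c y :
  adjoint_seminorm i (c *: y) = `|c| * adjoint_seminorm i y.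
Proof.
have Zle d z : adjoint_seminorm i (d *: z) <= `|d| * adjoint_seminorm i z.
  apply: opnorm_le => [|v]; first by rewrite mulr_ge0 ?opnorm_ge0.
  rewrite lin_adjointE coform_trZ normrM -mulrA ler_wpM2l//.
  by rewrite -lin_adjointE le_opnorm.
apply/eqP; rewrite eq_le Zle /=.
have [->|c0] := eqVneq c 0; first by rewrite normr0 mul0r opnorm_ge0.
rewrite -ler_pdivlMl ?normr_gt0// -normfV.
by rewrite -{1}(scale1r y) -(mulVf c0) -scalerA Zle.
Qed.

Let functional_ofP c a b y :
  functional_of (c *: a + b) y = c * functional_of a y + functional_of b y :> R.
Proof.
rewrite /functional_of !coformE.
rewrite (_ : (lsubmx _)^T = c *: (lsubmx a)^T + (lsubmx b)^T).
  by rewrite mulmxDr -scalemxAr mxE [X in X + _]mxE.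
by apply/colP => j; rewrite !mxE.
Qed.

Let multiplier_ofP c a b i u : multiplier_of (c *: a + b) i u =
  c * multiplier_of a i u + multiplier_of b i u :> R.
Proof.
rewrite /multiplier_of !coformE.
rewrite (_ : (submxrow (rsubmx (c *: a + b)) i)^T =
  c *: (submxrow (rsubmx a) i)^T + (submxrow (rsubmx b) i)^T).
  by rewrite mulmxDr -scalemxAr mxE [X in X + _]mxE.
by apply/colP => j; rewrite !mxE.
Qed.

Lemma closed_le_continuous (T : topologicalType) (f g : T -> R) :
  continuous f -> continuous g -> closed [set x | f x <= g x].
Proof.
move=> fc gc.
rewrite (_ : [set x | _] = (fun x => f x - g x) @^-1` [set r | r <= 0]).
  apply: preimage_closed; last exact: closed_le.
  by move=> x _; apply: cvgB; [exact: fc | exact: gc].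
by apply/seteqP; split => x /=; rewrite subr_le0.
Qed.

Let scalar_continuous (f : 'rV[R]_(1 + n) -> R) :
  (forall c a b, f (c *: a + b) = c * f a + f b) -> continuous f.
Proof.
move=> fP; have f0 : f 0 = 0.
  by have := fP (-1) 0 0; rewrite scaler0 addr0 mulN1r addNr.
apply: linear_rV_continuous => [x y|a x].
  by have := fP 1 x y; rewrite scale1r mul1r.
by have := fP a x 0; rewrite !addr0 f0 addr0.
Qed.

(** Requiring coordinate norm 1 replaces the non-closed condition [y' <> 0]; the rest is an
    intersection of weak inequalities between continuous functions, one for each [u] and each pair
    of the graph. *)
Let closed_constraints : closed constraints.
Proof.
have rc : continuous (fun e : 'rV[R]_(1 + n) => lsubmx e 0 0).
  by apply: scalar_continuous => c a b; rewrite !mxE.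
have rP (c : R) (a b : 'rV[R]_(1 + n)) :
  rsubmx (c *: a + b) = c *: rsubmx a + rsubmx b by apply/rowP => j; rewrite !mxE.
have mc i u :
    continuous (fun e : 'rV[R]_(1 + n) => multiplier_of (rsubmx e) i u : R).
  by apply: scalar_continuous => c a b; rewrite rP multiplier_ofP.
have fc y :
    continuous (fun e : 'rV[R]_(1 + n) => functional_of (rsubmx e) y : R).
  by apply: scalar_continuous => c a b; rewrite rP functional_ofP.
have Nc i : continuous (fun e : 'rV[R]_(1 + n) =>
    opnorm (lin_adjoint (P i) (functional_of (rsubmx e)))).
  apply: seminorm_continuous => [a b|c a].
    have -> : rsubmx (a + b) = rsubmx a + rsubmx b.
      by apply/rowP => j; rewrite !mxE.
    rewrite /functional_of; have -> : lsubmx (rsubmx a + rsubmx b : 'rV[R]_n) =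
      lsubmx (rsubmx a : 'rV[R]_n) + lsubmx (rsubmx b : 'rV[R]_n).
      by apply/rowP => j; rewrite !mxE.
    exact: adjoint_seminormD.
  have -> : rsubmx (c *: a) = c *: rsubmx a by apply/rowP => j; rewrite !mxE.
  rewrite /functional_of; have -> : lsubmx (c *: rsubmx a : 'rV[R]_n) =
      c *: lsubmx (rsubmx a : 'rV[R]_n).
    by apply/rowP => j; rewrite !mxE.
  exact: adjoint_seminormZ.
rewrite (_ : constraints =
  [set e | 0 <= lsubmx e 0 0] `&`
  [set e | `|lsubmx (rsubmx e)| = 1] `&`
  (\bigcap_i \bigcap_(u in [set: U i])
    [set e | `|multiplier_of (rsubmx e) i u| <= lsubmx e 0 0 *
      opnorm (lin_adjoint (P i) (functional_of (rsubmx e))) * `|u| ]) `&`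
  (\bigcap_(p in [set p : X * Y | F p.1 p.2])
    [set e | \sum_i (multiplier_of (rsubmx e) i (Q i p.1) : R) <=
             (functional_of (rsubmx e) p.2 : R)])); last first.
  apply/seteqP; split => e.
    case=> r0 a1 me He; do !split => //; first by move=> i _ u _; exact: me.
    by case=> x y /= Fxy; exact: He.
  case=> [[[r0 a1] me] He]; split => //; first by move=> i u; exact: me.
  by move=> x y Fxy; exact: (He (x, y)).
apply: closedI; last first.
  apply: closed_bigI => -[x y] _; apply: closed_le_continuous => //=.
  apply: scalar_continuous => c a b.
  rewrite mulr_sumr -big_split; apply: eq_bigr => i _ /=.
  by rewrite rP multiplier_ofP.
apply: closedI; last first.
  apply: closed_bigI => i _; apply: closed_bigI => u _; apply: closed_le_continuous.
    move=> e.
      exact: (@continuous_comp _ _ _ _ _ _ (mc i u e) (@norm_continuous _ R _)).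
  by move=> e; exact: cvgM (cvgM (rc e) (Nc i e)) (cvg_cst _).
apply: closedI.
  apply: (@closed_le_continuous _ (fun=> 0)); last exact: rc.
  exact: cst_continuous.
rewrite (_ : [set e | _] =
  (fun e : 'rV[R]_(1 + n) => `|lsubmx (rsubmx e)|) @^-1` [set 1]) //.
apply: preimage_closed; last exact: closed_eq.
move=> e _; apply: seminorm_continuous => [a b|c a].
  by rewrite !linearD ler_normD.
by rewrite !linearZ normrZ.
Qed.

(** Feasibility is homogeneous in [(y', m)], so both can be divided by the coordinate norm of
    [y']. *)
Let feasible_constraints (r : R) : 0 <= r -> feasible F P Q r ->
  exists2 e, constraints e & lsubmx e 0 0 = r.
Proof.
move=> r0 [y' [m [y'0 mle H]]].
pose coords (W : finNormedModType R) (f : 'Hom(W, R^o)) : 'rV[R]_(dim W) :=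
  \row_i (f (r2v (delta_mx 0 i)) : R).
have coordsK (W : finNormedModType R) (f : 'Hom(W, R^o)) :
    coform (coords W f)^T = f.
  by rewrite -[RHS]coform_hom; congr coform; apply/colP => i; rewrite !mxE.
have y'n0 : coords _ y' != 0.
  apply: contra_not_neq y'0 => c0; rewrite -(coordsK _ y') c0.
  by apply/lfunP => y; rewrite coformE trmx0 mulmx0 mxE zero_lfunE.
have y'_gt0 : 0 < `|coords _ y'| by rewrite normr_gt0.
pose c := `|coords _ y'|^-1.
have c0 : 0 < c by rewrite invr_gt0.
have cZ (W : finNormedModType R) (f : 'Hom(W, R^o)) w :
    coform (c *: coords W f)^T w = c * f w :> R.
  by rewrite coformE linearZ /= -scalemxAr mxE -coformE coordsK.
pose a : 'rV[R]_n := row_mx (c *: coords _ y') (\mxrow_i (c *: coords _ (m i))).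
have aY y : functional_of a y = c * y' y :> R.
  by rewrite /functional_of /a row_mxKl cZ.
have aU i u : multiplier_of a i u = c * m i u :> R.
  by rewrite /multiplier_of /a row_mxKr mxrowK cZ.
exists (row_mx r%:M a : 'rV[R]_(1 + n)); last by rewrite row_mxKl mxE mulr1n.
rewrite /constraints /= row_mxKl row_mxKr mxE mulr1n; split=> //.
- by rewrite row_mxKl normrZ gtr0_norm// mulVf// gt_eqF.
- move=> i u; rewrite aU normrM gtr0_norm//.
  apply: (@le_trans _ _ (c * (r * opnorm (lin_adjoint (P i) y') * `|u|))).
    by rewrite ler_pM2l//; exact: mle.
  rewrite mulrA ler_wpM2r// mulrCA ler_wpM2l// -ler_pdivlMl//.
  apply: opnorm_le => [|v].
    by rewrite mulr_ge0 ?opnorm_ge0 ?invr_ge0// ltW.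
  rewrite -mulrA ler_pdivlMl// -{1}(gtr0_norm c0) -normrM lin_adjointE -aY.
  by rewrite -lin_adjointE le_opnorm.
- move=> x y Fxy; rewrite aY; under eq_bigr do rewrite aU.
  by rewrite -mulr_sumr ler_pM2l//; exact: H.
Qed.

Let constraints_feasible e : constraints e -> feasible F P Q (lsubmx e 0 0).
Proof.
case=> r0 a1 me He.
exists (functional_of (rsubmx e)), (multiplier_of (rsubmx e)); split => // f0.
have /eqP : lsubmx (rsubmx e : 'rV[R]_n) = 0.
  apply: trmx_inj; rewrite trmx0; apply: coform_eq0 => y.
  by rewrite -/(functional_of _) f0 zero_lfunE.
by rewrite -normr_eq0 a1 oner_eq0.
Qed.

(** The radius is continuous and is minimised over the constraints with radius at most a known
    feasible [b]. This set is bounded because the norm bounds control [m] in terms of [b] and the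
    normalised [y']. *)
Lemma feasible_min : (exists2 r, 0 <= r & feasible F P Q r) ->
  exists r0, [/\ 0 <= r0, feasible F P Q r0 &
    forall r, 0 <= r -> feasible F P Q r -> r0 <= r].
Proof.
case=> b b0 bfeas; pose rad (e : 'rV[R]_(1 + n)) := lsubmx e 0 0.
have rc : continuous rad.
  by apply: scalar_continuous => c x y; rewrite /rad !mxE.
pose S := constraints `&` [set e | rad e <= b].
have [e0 Ce0 re0] := feasible_constraints b0 bfeas.
have S0 : S !=set0 by exists e0; split => //; rewrite /= /rad re0.
have cS : compact S.
  apply: bounded_closed_compact; last first.
    apply: closedI; first exact: closed_constraints.
    by apply: (closed_le_continuous rc); exact: cst_continuous.
  have Cex i : {C : R | 0 <= C /\ forall y, adjoint_seminorm i y <= C * `|y|}.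
    apply: cid; have [C C0 HC] := seminorm_le_norm (@adjoint_seminormD i)
      (@adjoint_seminormZ i); by exists C.
  pose C i := sval (Cex i).
  have C0 i : 0 <= C i by rewrite /C; case: (Cex i) => ? [].
  have HC i y : adjoint_seminorm i y <= C i * `|y|.
    by rewrite /C; case: (Cex i) => ? [] _ /=.
  (* Bounds coordinate [l] of the multiplier [m i], which is its value at the basis vector [l];
     [C i] bounds the norm of [P_i^* y'] for normalised [y']. *)
  pose B i l := b * C i * `|r2v (delta_mx 0 l) : U i|.
  have B0 i l : 0 <= B i l by rewrite !mulr_ge0.
  (* The three summands dominate the radius, the coordinates of [y'] and those of the
     multipliers. *)
  pose M := b + (1 + \sum_i \sum_l B i l).
  have SB0 : 0 <= \sum_i \sum_l B i l by do 2!apply: sumr_ge0 => ? _.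
  exists M; split; first exact: num_real.
  move=> N MN e [[/= r0 a1 me _] /= rb]; apply: le_trans (ltW MN).
  rewrite [leLHS]/Num.norm /= mx_normrE; apply/bigmax_leP; split.
    by rewrite !addr_ge0.
  move=> [z j] _ /=; rewrite (ord1 z) {z}.
  case: (split_ordP j) => {j} j ->.
    have -> : e 0 (lshift n j) = rad e by rewrite (ord1 j) /rad mxE.
    by rewrite ger0_norm// (le_trans rb)// lerDl addr_ge0.
  have -> : e 0 (rshift 1 j) = (rsubmx e) 0 j by rewrite mxE.
  case: (split_ordP j) => {j} j ->.
    have -> : rsubmx e 0 (lshift _ j) = lsubmx (rsubmx e : 'rV[R]_n) 0 j.
      by rewrite [RHS]mxE.
    apply: (@le_trans _ _ 1); last by rewrite /M addrCA lerDl addr_ge0.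
    rewrite -a1 [leRHS]/Num.norm /= mx_normrE.
    exact: (le_bigmax _ (fun ij => `|lsubmx (rsubmx e) ij.1 ij.2|) (0, j)).
  have -> : rsubmx e 0 (rshift _ j) = rsubmx (rsubmx e : 'rV[R]_n) 0 j.
    by rewrite [RHS]mxE.
  rewrite -(submxrowK (rsubmx _)) mxE.
  set i := tagnat.sig1 j; set l := tagnat.sig2 j.
  have -> : submxrow (rsubmx (rsubmx e : 'rV[R]_n)) i 0 l =
      multiplier_of (rsubmx e) i (r2v (delta_mx 0 l)).
    by rewrite coformE r2vK -rowE !mxE.
  apply: le_trans (me _ _) _; apply: (@le_trans _ _ (B i l)).
    rewrite ler_wpM2r// ler_pM// ?opnorm_ge0//.
    by have := HC i (lsubmx (rsubmx e : 'rV[R]_n)); rewrite a1 mulr1.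
  apply: (@le_trans _ _ (\sum_l B i l)).
    by rewrite (bigD1 l)//= lerDl sumr_ge0.
  apply: (@le_trans _ _ (\sum_i \sum_l B i l)).
    by rewrite [leRHS](bigD1 i)//= lerDl; do 2!apply: sumr_ge0 => ? _.
  by rewrite /M addrA lerDr addr_ge0.
have [e /set_mem[Ce _] emin] := EVT_min_rV S0 cS (continuous_subspaceT rc).
exists (rad e); split; first by case: Ce.
  exact: constraints_feasible.
move=> r r0 rfeas; have [rb|/ltW br] := leP r b.
  have [e1 Ce1 re1] := feasible_constraints r0 rfeas.
  by rewrite -re1 emin//; apply/mem_set; split => //; rewrite /= /rad re1.
(* A feasible radius above [b] exceeds the minimum, since [e0] has radius [b]. *)
apply: le_trans br; rewrite -re0 emin//; apply/mem_set; split => //.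
by rewrite /= /rad re0.
Qed.

End Minimum.

(** * Equality and attainment of the four infima *)

(** Finite members of [A] are levels satisfying [p], and a member equal to [+oo] never lowers an
    infimum; so the infimum depends on [p] alone. *)
Lemma ereal_inf_eq_real_levels {R : realType} (A : set (\bar R)) (p : R -> Prop) :
  (forall t, A t -> (0 <= t)%E) ->
  (forall r, A r%:E -> p r) ->
  (forall r, 0 <= r -> p r -> exists2 t, A t & (t <= r%:E)%E) ->
  ereal_inf A = ereal_inf [set r%:E | r in [set r | 0 <= r /\ p r]].
Proof.
move=> A0 Ap pA; apply/eqP; rewrite eq_le; apply/andP; split.
  apply: le_ereal_inf_tmp => _ [r [r0 pr] <-].
  by have [t At] := pA r r0 pr; apply: le_trans; exact: ereal_inf_lbound.
apply: le_ereal_inf_tmp => t At.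
have := A0 t At; case: t At => [r Ar|_ _|//]; last by rewrite leey.
rewrite lee_fin => r0; apply: ereal_inf_lbound; exists r => //.
by split => //; exact: Ap.
Qed.

(** The member [t] is squeezed between the infimum and [r]. *)
Lemma ereal_inf_attained {R : realType} (A : set (\bar R)) (r : R) t :
  A t -> (t <= r%:E)%E -> ereal_inf A = r%:E -> A (ereal_inf A).
Proof.
move=> At tr infA; rewrite infA (_ : r%:E = t)//.
by apply/eqP; rewrite eq_le tr andbT -infA; exact: ereal_inf_lbound.
Qed.

Theorem theorem5p1 (R : realType) (k : nat) (k_ge1 : (1 <= k)%N)
  (X Y : finNormedModType R) (U V : 'I_k -> finNormedModType R)
  (F : X -> set Y)
  (F_closed : sv_closed F) (F_sublinear : sublinear F)
  (F_surjective : sv_surjective F)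
  (P : forall i : 'I_k, 'Hom(V i, Y)) (Q : forall i : 'I_k, 'Hom(X, U i)) :
  [/\ ereal_inf (linear_values F P Q) = ereal_inf (rank_one_values F P Q),
      ereal_inf (rank_one_values F P Q) = ereal_inf (dual_values F P Q) &
      ereal_inf (dual_values F P Q) = ereal_inf (primal_values F P Q)] /\
  (ereal_inf (linear_values F P Q) \is a fin_num ->
    [/\ linear_values F P Q (ereal_inf (linear_values F P Q)),
        rank_one_values F P Q (ereal_inf (rank_one_values F P Q)),
        dual_values F P Q (ereal_inf (dual_values F P Q)) &
        primal_values F P Q (ereal_inf (primal_values F P Q))]).
Proof.
pose p := feasible F P Q.
have infE A : (forall t, A t -> (0 <= t)%E) -> (forall r, A r%:E -> p r) ->
    (forall r, 0 <= r -> p r -> exists2 t, A t & (t <= r%:E)%E) ->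
    ereal_inf A = ereal_inf [set r%:E | r in [set r | 0 <= r /\ p r]].
  exact: ereal_inf_eq_real_levels.
have lin_ge0 t : linear_values F P Q t -> (0 <= t)%E.
  by move=> /(feasible_of_linear F_sublinear)[r [r0 -> _]]; rewrite lee_fin.
have lin_p r : linear_values F P Q r%:E -> p r.
  by move=> /(feasible_of_linear F_sublinear)[r' [_ [->]]].
have p_rk r : 0 <= r -> p r ->
    exists2 t, rank_one_values F P Q t & (t <= r%:E)%E.
  exact: feasible_rank_one.
have p_lin r : 0 <= r -> p r ->
    exists2 t, linear_values F P Q t & (t <= r%:E)%E.
  by move=> r0 /(p_rk r r0)[t rk_t tr]; exists t => //; exact: rank_one_linear.
have p_dual r : 0 <= r -> p r -> exists2 t, dual_values F P Q t & (t <= r%:E)%E.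
  exact: feasible_dual.
have p_primal r : 0 <= r -> p r ->
    exists2 t, primal_values F P Q t & (t <= r%:E)%E.
  exact: feasible_primal.
have linE := infE _ lin_ge0 lin_p p_lin.
have rkE := infE _ (fun t h => lin_ge0 t (rank_one_linear h))
  (fun r h => lin_p r (rank_one_linear h)) p_rk.
have dualE := infE _ (@dual_values_ge0 _ _ _ _ _ _ F P Q)
  (@feasible_of_dual _ _ _ _ _ _ F P Q) p_dual.
have primalE := infE _ (@primal_values_ge0 _ _ _ _ _ _ F P Q)
  (@feasible_of_primal _ _ _ _ _ _ F F_sublinear P Q) p_primal.
split; first by rewrite linE rkE dualE primalE.
rewrite linE => inf_fin.
have [r0 [r0_ge0 pr0 r0_min]] : exists r0, [/\ 0 <= r0, p r0 &
    forall r, 0 <= r -> p r -> r0 <= r].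
  (* Without a feasible radius the infimum would be over the empty set, hence [+oo], against
     finiteness. *)
  apply: feasible_min; apply: contrapT => none; move: inf_fin.
  rewrite (_ : [set _ | _ in _] = set0) ?ereal_inf0//.
  apply/seteqP; split => // t [r [r_ge0 pr] _].
  by apply: none; exists r.
have infr0 : ereal_inf [set r%:E | r in [set r | 0 <= r /\ p r]] = r0%:E.
  apply/eqP; rewrite eq_le; apply/andP; split.
    by apply: ereal_inf_lbound; exists r0.
  by apply: le_ereal_inf_tmp => _ [r [r_ge0 pr] <-]; rewrite lee_fin r0_min.
(* The least feasible radius bounds a member of each of the four sets, and that member is the
   infimum. *)
have [t1 At1 t1r] := p_lin _ r0_ge0 pr0.
have [t2 At2 t2r] := p_rk _ r0_ge0 pr0.
have [t3 At3 t3r] := p_dual _ r0_ge0 pr0.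
have [t4 At4 t4r] := p_primal _ r0_ge0 pr0.
rewrite -linE; split.
- by apply: ereal_inf_attained At1 t1r _; rewrite linE.
- by apply: ereal_inf_attained At2 t2r _; rewrite rkE.
- by apply: ereal_inf_attained At3 t3r _; rewrite dualE.
- by apply: ereal_inf_attained At4 t4r _; rewrite primalE.
Qed.
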